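(* Let $\pi:\widetilde X\to X$ be a good resolution of a normal surface singularity $(X,o)$ whose link is a rational homology sphere. Then, with the notation of the context, $$\sum_{l'\in\mathcal S'}\ \sum_{I\subset\mathcal V}(-1)^{|I|+1}\,\chi\big(l'+E_{J(l',I)}\big)\,\mathbf t^{l'}=Z(\mathbf t),$$ where the inner sum runs over all subsets $I$ of $\mathcal V$ (including $\emptyset$). Equivalently, writing $l'=\sum_j n_jE_j^*$ and $\mathbf x^{\mathbf n}=x_1^{n_1}\cdots x_s^{n_s}$, $$\sum_{\mathbf n\ge 0}\ \sum_{I\subset\mathcal V}(-1)^{|I|+1}\chi\big(l'+E_{J(l',I)}\big)\,\mathbf x^{\mathbf n}=\prod_{j\in\mathcal V}(1-x_j)^{\delta_j-2}$$ (the right-hand side being expanded at the origin); that is, for every $l'=\sum_j n_jE_j^*$ with all $n_j\in\mathbb Z_{\ge 0}$, $$\sum_{I\subset\mathcal V}(-1)^{|I|+1}\chi\big(l'+E_{J(l',I)}\big)=\prod_{j\in\mathcal V}\chi_{\delta_j,n_j}.$$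
   Context: $(X,o)$ is a complex analytic normal surface singularity whose link $\Sigma$ is a rational homology sphere; $\pi:\widetilde X\to X$ is a good resolution with exceptional curve $E=\bigcup_{j\in\mathcal V}E_j$, $\mathcal V=\{1,\dots,s\}$, a normal crossing divisor with smooth components. Hence the dual graph $\Gamma$ is a connected tree and each $E_j\cong\mathbb P^1$; $\delta_j$ is the valency of $j$ in $\Gamma$. $L=\bigoplus_j\mathbb ZE_j$ carries the negative definite intersection form $(\cdot,\cdot)$, extended to $L_{\mathbb Q}=L\otimes\mathbb Q$. $L'=H_2(\widetilde X,\Sigma,\mathbb Z)$ is identified with $\{l'\in L_{\mathbb Q}:(l',E_j)\in\mathbb Z\ \forall j\}$; it has basis $\{E_j^*\}_j$ determined by $(E_i^*,E_j)=-\delta_{ij}$ (Kronecker delta). $\mathcal S'=\{l'\in L':(l',E_j)\le 0\ \forall j\}$, which is the set of all $\sum_jn_jE_j^*$ with $n_j\in\mathbb Z_{\ge0}$. For $l'=\sum_j l'_jE_j\in L'$ put $\mathbf t^{l'}=\prod_j t_j^{l'_j}$. For $I\subset\mathcal V$ put $E_I=\sum_{j\in I}E_j$. The canonical cycle $K_{\widetilde X}\in L'$ is determined by $(K_{\widetilde X}+E_j,E_j)=-2$ for all $j$, and $\chi(l')=-(l',l'+K_{\widetilde X})/2$ for $l'\in L_{\mathbb Q}$. For $l'\in L'$ and $I\subset\mathcal V$, $J(l',I)$ denotes the unique minimal subset $J\subset\mathcal V$ such that $I\subset J$ and there is no $j\in\mathcal V\setminus J$ with $(E_j,l'+E_J)>0$.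 For $\delta,n\ge0$, $\chi_{\delta,n}$ is the coefficient of $x^n$ in the Taylor expansion at the origin of $(1-x)^{\delta-2}$, and $$Z(\mathbf t)=\sum_{l'=\sum n_jE_j^*\in\mathcal S'}\Big(\prod_{j\in\mathcal V}\chi_{\delta_j,n_j}\Big)\mathbf t^{l'}.$$ *)

(* Defs.v *)
From mathcomp Require Import all_boot all_order all_algebra.
From mathcomp Require Import all_classical all_reals all_analysis.

Set Implicit Arguments.
Unset Strict Implicit.
Unset Printing Implicit Defensive.

Import Order.TTheory GRing.Theory Num.Theory.
Import numFieldNormedType.Exports.

Local Open Scope ring_scope.
Local Open Scope classical_set_scope.

(** * Resolution graphs *)

(* (E_i, E_j) in the basis of exceptional curves: distinct curves that meet do
   so transversally in a single point, the dual graph having no multiple edge. *)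
Definition intersection_matrix (s : nat) (adj : rel 'I_s)
    (selfint : 'I_s -> int) : 'M[rat]_s :=
  \matrix_(i, j) (if i == j then (selfint i)%:~R else (adj i j)%:R).

Definition bilinear_form (s : nat) (M : 'M[rat]_s) (u v : 'rV[rat]_s) : rat :=
  (u *m M *m v^T) 0 0.

(* The combinatorial data of a good resolution of a normal surface singularity
   with rational homology sphere link: the dual graph, which is a (nonempty)
   tree of rational curves, and the self-intersection numbers.
   By theorems of Mumford and Grauert, these are exactly the data for which
   the intersection form is negative definite. *)
Record resolution_graph := ResolutionGraph {
  nvert : nat;
  adj : rel 'I_nvert;
  selfint : 'I_nvert -> int;
  nvert_gt0 : (0 < nvert)%N;
  adj_sym : symmetric adj;
  adj_irr : irreflexive adj;
  adj_connected : forall i j, connect adj i j;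
  (* [ucycle adj [:: i; j]] holds for every edge; a genuine cycle has size > 2 *)
  adj_acyclic : forall c : seq 'I_nvert, ucycle adj c -> (size c <= 2)%N;
  form_negdef : forall u : 'rV[rat]_nvert, u != 0 ->
    bilinear_form (intersection_matrix adj selfint) u u < 0 }.

(* L_Q: a vector is the row of its coordinates in the basis (E_j). *)
Notation LQ G := 'rV[rat]_(nvert G).

Section ResolutionGraph.
Variable G : resolution_graph.
Local Notation V := 'I_(nvert G).

Definition imat : 'M[rat]_(nvert G) :=
  intersection_matrix (@adj G) (@selfint G).

Definition form (u v : LQ G) : rat := bilinear_form imat u v.

Definition valency (j : V) : nat := #|[set i | adj j i]%SET|.

Definition E (j : V) : LQ G := delta_mx 0 j.

Definition Esum (I : {set V}) : LQ G := \sum_(j in I) E j.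

Definition Lprime : set (LQ G) := [set l | forall j, form l (E j) \is a Num.int].

Definition Sprime : set (LQ G) :=
  [set l | Lprime l /\ forall j, form l (E j) <= 0].

(* Characterized by [form_Estar] and [Estar_unique]. *)
Definition Estar (i : V) : LQ G := - row i (invmx imat).

Definition dual_comb (n : {ffun V -> nat}) : LQ G := \sum_j Estar j *+ n j.

(* Characterized by [canonicalP] and [canonical_unique]. *)
Definition canonical : LQ G :=
  (\row_j (- 2 - form (E j) (E j))) *m invmx imat.

Definition chi (l : LQ G) : rat := - form l (l + canonical) / 2.

Definition J_admissible (l : LQ G) (I J : {set V}) : bool :=
  (I \subset J) && ~~ [exists j, (j \notin J) && (0 < form (E j) (l + Esum J))].

(* Existence and uniqueness of the minimal set: [J_minset] and [J_unique]. *)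
Definition J (l : LQ G) (I : {set V}) : {set V} :=
  odflt finset.setT [pick A | minset (J_admissible l I) A].

Definition chi_alt_sum (l : LQ G) : rat :=
  \sum_(I : {set V}) (-1) ^+ #|I|.+1 * chi (l + Esum (J l I)).

End ResolutionGraph.

(** * Formal series *)

(* The coefficient of x^n in the Taylor expansion at 0 of (1 - x)^(delta - 2);
   the exponent may be negative. *)
Definition chi_coef (R : realType) (delta n : nat) : R :=
  derive1n n (fun x : R => (1 - x) ^ (delta%:Z - 2)) 0 / n`!%:R.

(* A formal series with exponents in M is its coefficient function. *)
Definition fseries (R : realType) (M : choiceType) : Type := M -> R.

(* \sum_(i \in D) a_i t^(e_i), for a family such that every exponent occurs
   finitely often: terms with the same exponent are added. *)
Definition formal_sum (R : realType) (M I : choiceType) (D : set I)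
    (a : I -> R) (e : I -> M) : fseries R M :=
  fun v => \sum_(i \in D `&` [set i | e i = v]) a i.

Notation expo s := {ffun 'I_s -> nat}.

Definition expo_add (s : nat) (m n : expo s) : expo s :=
  [ffun i => (m i + n i)%N].

Definition fps_one (R : realType) (s : nat) : fseries R (expo s) :=
  fun v => (v == [ffun => 0%N])%:R.

Definition fps_mul (R : realType) (s : nat) (F G : fseries R (expo s)) :
    fseries R (expo s) :=
  fun v => \sum_(p \in [set p : expo s * expo s | expo_add p.1 p.2 = v])
             F p.1 * G p.2.

Definition var_pow (s : nat) (j : 'I_s) (n : nat) : expo s :=
  [ffun i => if i == j then n else 0%N].

(* The expansion at the origin of (1 - x_j)^(delta - 2), in R[[x_1, ..., x_s]]. *)
Definition one_sub_var_pow (R : realType) (s : nat) (j : 'I_s) (delta : nat) :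
    fseries R (expo s) :=
  formal_sum [set: nat] (chi_coef R delta) (var_pow j).

(* The factor coefficients are integers, but live in R since they are defined
   as Taylor coefficients. *)
Definition Zseries (R : realType) (G : resolution_graph) : fseries R (LQ G) :=
  formal_sum [set: expo (nvert G)]
    (fun n => \prod_j chi_coef R (valency j) (n j)) (@dual_comb G).

Arguments Sprime : clear implicits.
Arguments Zseries : clear implicits.
Arguments fps_mul : clear implicits.
Arguments fps_one : clear implicits.

(** * The definitions are the intended ones *)

Lemma formal_sum_inj (R : realType) (M I : choiceType) (D : set I)
    (a : I -> R) (e : I -> M) (i : I) :
  {in D &, injective e} -> D i -> formal_sum D a e (e i) = a i.
Proof.
move=> einj Di; rewrite /formal_sum.
rewrite (_ : _ `&` _ = [set i]) ?fsbig_set1//.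
apply/seteqP; split=> [k [Dk /=]|k /= ->//].
by apply: einj; apply/mem_set.
Qed.

Lemma fps_mul_finite (s : nat) (v : expo s) :
  finite_set [set p : expo s * expo s | expo_add p.1 p.2 = v].
Proof.
pose B := (\max_i v i).+1.
pose f (g : {ffun 'I_s -> 'I_B}) : expo s := [ffun i => val (g i)].
have fB (w : expo s) : (forall i, w i <= v i)%N -> exists g, f g = w.
  move=> wv; exists [ffun i => inord (w i)]; apply/ffunP => i.
  by rewrite !ffunE /= inordK// ltnS (leq_trans (wv i))// (leq_bigmax i).
apply: (@sub_finite_set _ _ (range (fun g : {ffun 'I_s -> 'I_B} *
   {ffun 'I_s -> 'I_B} => (f g.1, f g.2)))); last first.
  by apply: finite_image; exact: finite_finset.
move=> [a b] /= abv.
have [|g ga] := fB a; first by move=> i; rewrite -abv ffunE leq_addr.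
have [|h hb] := fB b; first by move=> i; rewrite -abv ffunE leq_addl.
by exists (g, h) => //=; rewrite ga hb.
Qed.

Section Characterizations.
Variable G : resolution_graph.
Local Notation V := 'I_(nvert G).
Implicit Types (l u v : LQ G) (i j : V) (A B I : {set V}).

Lemma form_E u j : form u (E j) = (u *m imat G) 0 j.
Proof.
rewrite /form /bilinear_form /E trmx_delta -[X in X = _]/((_ *m _) 0 0).
by rewrite -colE mxE.
Qed.

Lemma form_EE i j :
  form (E i) (E j) = if i == j then (selfint i)%:~R else (adj i j)%:R.
Proof. by rewrite form_E -rowE mxE mxE. Qed.

Lemma formDl u v w : form (u + v) w = form u w + form v w.
Proof. by rewrite /form /bilinear_form !mulmxDl mxE. Qed.

Lemma formDr u v w : form w (u + v) = form w u + form w v.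
Proof. by rewrite /form /bilinear_form linearD mulmxDr mxE. Qed.

Lemma form0r w : @form G w 0 = 0.
Proof. by rewrite /form /bilinear_form linear0 mulmx0 mxE. Qed.

Lemma imat_unit : imat G \in unitmx.
Proof.
rewrite -row_free_unit -kermx_eq0; apply/negPn/negP => /rowV0Pn[u].
move=> /sub_kermxP uM /(form_negdef (r := G)).
by rewrite /bilinear_form -/(imat G) uM mul0mx mxE ltxx.
Qed.

Lemma form_E_inj u v : (forall j, form u (E j) = form v (E j)) -> u = v.
Proof.
move=> uv; apply: (can_inj (mulmxK imat_unit)).
by apply/rowP => j; rewrite -!form_E.
Qed.

Lemma form_Estar i j : form (Estar i) (E j) = - (i == j)%:R.
Proof.
by rewrite form_E mulNmx -row_mul mulVmx ?imat_unit// !mxE.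
Qed.

Lemma Estar_unique i u :
  (forall j, form u (E j) = - (i == j)%:R) -> u = Estar i.
Proof. by move=> h; apply: form_E_inj => j; rewrite h form_Estar. Qed.

Lemma canonicalP j : form (canonical G + E j) (E j) = - 2.
Proof.
by rewrite formDl [form (canonical G) _]form_E mulmxKV ?imat_unit// mxE subrK.
Qed.

Lemma canonical_unique u :
  (forall j, form (u + E j) (E j) = - 2) -> u = canonical G.
Proof.
move=> h; apply: form_E_inj => j; apply: (addIr (form (E j) (E j))).
by rewrite -!formDl h canonicalP.
Qed.

Lemma dual_comb_inj : injective (@dual_comb G).
Proof.
have coord (n : {ffun V -> nat}) j : form (dual_comb n) (E j) = - (n j)%:R.
  rewrite form_E mulmx_suml summxE (bigD1 j)//= big1 ?addr0 => [|i /negPf ij].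
    by rewrite -form_E -scaler_nat /form /bilinear_form -!scalemxAl mxE
      -/(bilinear_form _ _ _) -/(form _ _) form_Estar eqxx mulrN1.
  by rewrite -form_E -scaler_nat /form /bilinear_form -!scalemxAl mxE
    -/(bilinear_form _ _ _) -/(form _ _) form_Estar ij oppr0 mulr0.
move=> m n mn; apply/ffunP => j; have := coord m j; rewrite mn coord.
by move=> /oppr_inj/eqP; rewrite eqr_nat => /eqP.
Qed.

Lemma form_Esum_mono j A B : A \subset B -> j \notin B ->
  form (E j) (Esum A) <= form (E j) (Esum B).
Proof.
move=> AB jB.
have -> : Esum B = Esum A + Esum (B :\: A).
  by rewrite /Esum (big_setID A)/= (finset.setIidPr AB).
rewrite formDr lerDl /Esum.
apply: (big_ind (fun u => 0 <= form (E j) u)) => [|u v u0 v0|i].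
- by rewrite form0r.
- by rewrite formDr addr_ge0.
rewrite finset.inE => /andP[_ iB]; rewrite form_EE; case: eqP => [ji|_].
  by rewrite ji iB in jB.
exact: ler0n.
Qed.

Lemma J_admissibleI l I A B :
  J_admissible l I A -> J_admissible l I B -> J_admissible l I (A :&: B).
Proof.
move=> /andP[IA /existsPn hA] /andP[IB /existsPn hB].
rewrite /J_admissible finset.subsetI IA IB/=; apply/existsPn => j.
apply/negP; rewrite finset.inE negb_and => /andP[/orP[jA|jB]].
  move: (hA j); rewrite jA/= -!leNgt !formDr leNgt => hj lt0.
  move: hj; rewrite (lt_le_trans lt0)// lerD2l form_Esum_mono//.
  exact: finset.subsetIl.
move: (hB j); rewrite jB/= -!leNgt !formDr leNgt => hj lt0.
move: hj; rewrite (lt_le_trans lt0)// lerD2l form_Esum_mono//.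
exact: finset.subsetIr.
Qed.

Lemma J_minset l I : minset (J_admissible l I) (J l I).
Proof.
rewrite /J; case: pickP => //= h.
have [|A] := @ex_minset _ (J_admissible l I).
  exists finset.setT; rewrite /J_admissible finset.subsetT/=.
  by apply/existsPn => j; rewrite finset.inE.
by rewrite h.
Qed.

Lemma J_unique l I A : minset (J_admissible l I) A -> A = J l I.
Proof.
move=> minA; have minJ := J_minset l I.
have adm := J_admissibleI (minsetp minA) (minsetp minJ).
by rewrite -(minsetinf minA adm (finset.subsetIl _ _))
  (minsetinf minJ adm (finset.subsetIr _ _)).
Qed.

End Characterizations.

(* Main.v *)
Require Import Defs.
From mathcomp Require Import all_boot all_order all_algebra.
From mathcomp Require Import all_classical all_reals all_analysis.
From mathcomp Require Import zify ring lra.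
(* Gives [form] precedence over the sesquilinear forms of that name. *)
Import Defs.

(** Put l' = \sum_j n_j E_j^* and m_j = n_j + 1. Bilinearity and adjunction give
    chi(l' + E_A) = chi(l') + g_m(A), where the energy
    g_m(A) = \sum_(j in A) m_j - #(edges inside A) lives on the dual graph alone
    ([chi_add_Esum]).

    The set J(l', I) minimizes g_m over all supersets of I ([min_energy_J]). A
    minimizer of largest cardinality is closed under the rule defining J, since
    applying the rule never raises the energy, so it contains J(l', I);
    conversely, each vertex outside J(l', I) has at most n_j neighbours inside,
    and a forest has no more edges than vertices, so enlarging J(l', I) never
    lowers the energy. As the constant chi(l') cancels in the alternating sum,
    what is left to compute is
    S(U, m) = \sum_(I <= U) (-1)^(|I|+1) min_(I <= K <= U) g_m(K)
    for U the whole tree.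

    This is done for every tree U and every integer weight m, by removing a leaf
    v attached to u ([alt_min_energy_leaf]). If m_v <= 0, then v may be put
    into K for free, so the minimum does not depend on whether v is in I, and
    S(U, m) = 0. If m_v > 0, then adding v to K never helps, and forcing v into
    K costs m_v and lowers the weight of u by 1; hence
    S(U, m) = S(U - v, m) - S(U - v, m - 1_u).
    The coefficients of x (1 - x)^(d - 2) satisfy the same recursion in d, so
    that S(U, m) = \prod_j [x^(m_j)] x (1 - x)^(d_j - 2)
    ([alt_min_energy_tree]). Allowing weights that are not positive is what
    makes the induction close.

    The coefficients are matched with Taylor coefficients in
    [chi_coef_trunc_diff]. The two identities of series follow coefficientwise,
    as dual_comb is a bijection onto S' and a product of series, each in a
    variable of its own, has product coefficients ([big_one_sub_var_powE]). *)

Set Implicit Arguments.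
Unset Strict Implicit.
Unset Printing Implicit Defensive.

Import Order.TTheory GRing.Theory Num.Theory.
Import numFieldNormedType.Exports.

Local Open Scope ring_scope.
Local Open Scope set_scope.

(** * Alternating sums over subsets *)

(** Pairs the subsets of v |: U into I and v |: I, with opposite signs. *)
Lemma alt_sumU1 (R : comNzRingType) (T : finType) (F : {set T} -> R)
    (v : T) (U : {set T}) : v \notin U ->
  \sum_(I : {set T} | I \subset v |: U) (-1) ^+ #|I|.+1 * F I
  = \sum_(I : {set T} | I \subset U) (-1) ^+ #|I|.+1 * (F I - F (v |: I)).
Proof.
move=> vU; rewrite (bigID (fun I : {set T} => v \in I))/=.
rewrite (reindex_onto (fun I => v |: I) (fun I => I :\ v))/=; last first.
  by move=> I /andP[_ vI]; rewrite finset.setD1K.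
rewrite [X in X + _](eq_bigl (fun I : {set T} => I \subset U)); last first.
  move=> I; rewrite setU11 andbT.
  apply/idP/idP => [/andP[+ /eqP vI]|IU].
    have vnI : v \notin I by rewrite -vI !inE eqxx.
    rewrite -{2}(setU1K vU) subsetD1 vnI andbT.
    by apply: fintype.subset_trans; exact: finset.subsetUr.
  have vnI : v \notin I by apply: contra vU; exact: fintype.subsetP.
  by rewrite setU1K// eqxx finset.setUS.
rewrite [X in _ + X](eq_bigl (fun I : {set T} => I \subset U)); last first.
  move=> I; rewrite -subsetD1; congr (_ \subset _).
  by rewrite setU1K.
rewrite -big_split/=; apply: eq_bigr => I IU.
have vnI : v \notin I by apply: contra vU; exact: fintype.subsetP.
by rewrite cardsU1 vnI add1n exprS; ring.
Qed.

Lemma alt_sum_eq0 (R : comNzRingType) (T : finType) (F : {set T} -> R)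
    (v : T) (U : {set T}) : v \in U ->
    (forall I : {set T}, I \subset U -> F (v |: I) = F I) ->
  \sum_(I : {set T} | I \subset U) (-1) ^+ #|I|.+1 * F I = 0.
Proof.
move=> vU FE; rewrite -(finset.setD1K vU) alt_sumU1 ?setD11// big1// => I.
by rewrite subsetD1 => /andP[IU _]; rewrite FE// subrr mulr0.
Qed.

(** * Iterated truncated differences *)

(** The coefficient of x^k in x (1 - x)^(d - 2), extended by 0 to k <= 0: for
    d = 0 the coefficient of x / (1 - x)^2 is k, and multiplication by 1 - x
    takes backward differences. *)
Fixpoint trunc_diff (d : nat) (k : int) : int :=
  if d is d'.+1 then trunc_diff d' k - trunc_diff d' (k - 1) else Num.max k 0.

Lemma trunc_diff_le0 d (k : int) : k <= 0 -> trunc_diff d k = 0.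
Proof.
elim: d k => [|d IH] k k0 /=; first exact: max_r.
by rewrite !IH ?subr0//; lia.
Qed.

Lemma trunc_diff1 k : trunc_diff 1 k = (0 < k)%R%:R.
Proof. by rewrite /=; case: ltP => k0; lia. Qed.

(** * Energy of vertex sets *)

Lemma big_setU_disjoint (R : Type) (idx : R) (op : Monoid.com_law idx)
    (I : finType) (A B : {set I}) (F : I -> R) : [disjoint A & B] ->
  \big[op/idx]_(i in A :|: B) F i =
    op (\big[op/idx]_(i in A) F i) (\big[op/idx]_(i in B) F i).
Proof.
by move=> AB; rewrite -bigU//; apply: eq_bigl => i; rewrite !inE.
Qed.

Section GraphEnergy.
Variables (T : finType) (e : rel T).
Hypotheses (e_sym : symmetric e) (e_irr : irreflexive e).
Implicit Types (u v : T) (A B I K U W : {set T}) (m : T -> int).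

Definition degree_in A v : nat := \sum_(i in A) e v i.

(** Half the sum of the degrees is the number of edges inside A. *)
Definition energy m A : rat :=
  \sum_(i in A) (m i)%:~R - (\sum_(i in A) degree_in A i)%:R / 2.

Lemma degree_inU A B v : [disjoint A & B] ->
  degree_in (A :|: B) v = (degree_in A v + degree_in B v)%N.
Proof. by move=> AB; rewrite /degree_in big_setU_disjoint. Qed.

Lemma energyU m A B : [disjoint A & B] ->
  energy m (A :|: B) = energy m A + energy m B
                       - (\sum_(i in B) degree_in A i)%:R.
Proof.
move=> AB; rewrite /energy !big_setU_disjoint//=.
rewrite (eq_bigr (fun i => degree_in A i + degree_in B i)%N); last first.
  by move=> i _; rewrite degree_inU.
rewrite [X in (_ + X)%N](eq_bigr (fun i => degree_in A i + degree_in B i)%N).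
  rewrite !big_split/=.
  have -> : (\sum_(i in A) degree_in B i = \sum_(i in B) degree_in A i)%N.
    rewrite /degree_in exchange_big/=; apply: eq_bigr => i _.
    by apply: eq_bigr => j _; rewrite e_sym.
  by rewrite !natrD; field.
by move=> i _; rewrite degree_inU.
Qed.

Lemma degree_in1 u v : degree_in [set u] v = e v u.
Proof. by rewrite /degree_in big_set1. Qed.

Lemma energy0 m : energy m finset.set0 = 0.
Proof. by rewrite /energy !big_set0 mul0r subr0. Qed.

Lemma energy1 m v : energy m [set v] = (m v)%:~R.
Proof. by rewrite /energy !big_set1 degree_in1 e_irr mul0r subr0. Qed.

Lemma energyU1 m v A : v \notin A ->
  energy m (v |: A) = energy m A + (m v)%:~R - (degree_in A v)%:R.
Proof.
move=> vA; rewrite finset.setUC energyU; first by rewrite energy1 big_set1.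
by rewrite disjoint_sym disjoints1.
Qed.

Lemma degree_in_mono A B v : A \subset B -> (degree_in A v <= degree_in B v)%N.
Proof.
move=> AB; rewrite /degree_in [leqRHS](big_setID A)/= (finset.setIidPr AB).
exact: leq_addr.
Qed.

Definition min_energy m U I : rat :=
  energy m [arg min_(K < U | (I \subset K) && (K \subset U)) energy m K]%O.

Variant min_energy_spec m U I : rat -> Type :=
  MinEnergySpec K of I \subset K & K \subset U &
    (forall A, I \subset A -> A \subset U -> energy m K <= energy m A) :
    min_energy_spec m U I (energy m K).

Lemma min_energyP m U I :
  I \subset U -> min_energy_spec m U I (min_energy m U I).
Proof.
move=> IU; rewrite /min_energy; case: arg_minP => [|K /andP[IK KU] Kmin].
  by rewrite IU subxx.
by split=> // A IA AU; apply: Kmin; rewrite IA.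
Qed.

Lemma min_energy_le m U I A : I \subset A -> A \subset U ->
  min_energy m U I <= energy m A.
Proof.
move=> IA AU.
by case: (min_energyP m (fintype.subset_trans IA AU)) => K _ _; apply.
Qed.

Lemma min_energy_eq m U I K : I \subset K -> K \subset U ->
    (forall A, I \subset A -> A \subset U -> energy m K <= energy m A) ->
  min_energy m U I = energy m K.
Proof.
move=> IK KU Kmin; apply/le_anti; rewrite min_energy_le//=.
by case: (min_energyP m (fintype.subset_trans IK KU)) => A IA AU _; exact: Kmin.
Qed.

Definition alt_min_energy m U : rat :=
  \sum_(I : {set T} | I \subset U) (-1) ^+ #|I|.+1 * min_energy m U I.

(** Trees, presented by the successive attachment of leaves: this gives the
    induction that removes a leaf. *)
Inductive grown_tree : {set T} -> Prop :=
| Grown1 v : grown_tree [set v]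
| GrownU1 u v U : grown_tree U -> u \in U -> v \notin U ->
    (forall w, w \in U -> e v w = (w == u)) -> grown_tree (v |: U).

(** A forest has at most as many edges as vertices. *)
Lemma grown_tree_energy1 U W : grown_tree U -> W \subset U ->
  0 <= energy (fun=> 1) W.
Proof.
move=> Ut; elim: Ut W => {U} [v|u v U _ IH uU vU vE] W.
  by rewrite subset1 => /orP[|] /eqP ->; rewrite ?energy0 ?energy1.
have [vW WU|vW WU] := boolP (v \in W); last first.
  by apply: IH; rewrite -(setU1K vU) subsetD1 WU.
have WvU : W :\ v \subset U by rewrite -(setU1K vU) finset.setSD.
rewrite -(finset.setD1K vW) energyU1 ?setD11//.
rewrite -addrA addr_ge0 ?IH// subr_ge0 ler_nat.
apply: (@leq_trans (degree_in U v)); first exact: degree_in_mono.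
rewrite /degree_in (bigD1 u)//= big1 ?addn0 => [|w /andP[wU]].
  exact: leq_b1.
by rewrite vE// => /negPf ->.
Qed.

Definition lower_at u m : T -> int := fun j => m j - (j == u)%:R.

Lemma energy_lower u m A : energy (lower_at u m) A = energy m A - (u \in A)%:R.
Proof.
rewrite /energy /lower_at addrAC; congr (_ - _).
rewrite (eq_bigr (fun j => (m j)%:~R - (j == u)%:R)) => [|j _]; last first.
  by case: eqP; rewrite rmorphB.
rewrite sumrB; congr (_ - _); case: (boolP (u \in A)) => uA.
  by rewrite (bigD1 u)//= eqxx big1 ?addr0// => j /andP[_ /negPf ->].
by rewrite big1// => j jA; case: eqP => // ju; rewrite -ju jA in uA.
Qed.

Section Leaf.
Variables (m : T -> int) (u v : T) (U : {set T}).
Hypotheses (uU : u \in U) (vU : v \notin U).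
Hypothesis vE : forall w, w \in U -> e v w = (w == u).

Lemma leaf_notin K : K \subset U -> v \notin K.
Proof. by move=> KU; apply: contra vU; exact: fintype.subsetP. Qed.

Lemma degree_in_leaf K : K \subset U -> degree_in K v = (u \in K).
Proof.
move=> KU; rewrite /degree_in; case: (boolP (u \in K)) => uK.
  rewrite (bigD1 u)//= vE// eqxx big1 => [|w /andP[wK /negPf wu]] //.
  by rewrite vE ?wu// (fintype.subsetP KU).
rewrite big1// => w wK; rewrite vE ?(fintype.subsetP KU)//.
by case: eqP => // wu; rewrite -wu wK in uK.
Qed.

Lemma energy_leaf K : K \subset U ->
  energy m (v |: K) = (m v)%:~R + energy (lower_at u m) K.
Proof.
move=> KU; rewrite energyU1 ?leaf_notin// degree_in_leaf// energy_lower.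
by rewrite addrAC addrC.
Qed.

(** A leaf that is forced into K turns the edge uv into a reward of 1 for the
    presence of u. *)
Lemma min_energy_leafU1 I : I \subset U ->
  min_energy m (v |: U) (v |: I) = (m v)%:~R + min_energy (lower_at u m) U I.
Proof.
move=> IU; case: (min_energyP (lower_at u m) IU) => K IK KU Kmin.
rewrite -energy_leaf//; apply: min_energy_eq => [||A]; try exact: finset.setUS.
rewrite finset.subUset finset.sub1set => /andP[vA IA] AU.
rewrite -(finset.setD1K vA) !energy_leaf//.
  rewrite lerD2l Kmin// ?subsetD1 ?IA ?leaf_notin//.
  by rewrite -(setU1K vU) finset.setSD.
by rewrite -(setU1K vU) finset.setSD.
Qed.

(** Dropping the leaf from K saves its weight, at least 1, and loses at most one
    edge. *)
Lemma min_energy_leaf_pos I : 0 < m v -> I \subset U ->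
  min_energy m (v |: U) I = min_energy m U I.
Proof.
move=> mv IU; case: (min_energyP m IU) => K IK KU Kmin.
apply: min_energy_eq => // [|A IA AU].
  exact: fintype.subset_trans (finset.subsetUr _ _).
have [vA|vA] := boolP (v \in A); last first.
  by apply: Kmin => //; rewrite -(setU1K vU) subsetD1 AU.
have AvU : A :\ v \subset U by rewrite -(setU1K vU) finset.setSD.
apply: (@le_trans _ _ (energy m (A :\ v))).
  by apply: Kmin => //; rewrite subsetD1 IA leaf_notin.
rewrite -[in leRHS](finset.setD1K vA) energyU1 ?setD11// -addrA lerDl subr_ge0.
rewrite degree_in_leaf//; apply: (@le_trans _ _ 1); first by case: (_ \in _).
by rewrite ler1z.
Qed.

(** Any competitor K may be replaced by v |: K, which costs nothing more. *)
Lemma min_energy_leaf_neg I : m v <= 0 -> I \subset U ->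
  min_energy m (v |: U) I = min_energy m (v |: U) (v |: I).
Proof.
move=> mv IU; case: (@min_energyP m (v |: U) (v |: I)).
  exact: finset.setUS.
move=> K; rewrite finset.subUset finset.sub1set => /andP[vK IK] KU Kmin.
apply: min_energy_eq => // A IA AU.
have [vA|vA] := boolP (v \in A).
  by apply: Kmin; rewrite // finset.subUset finset.sub1set vA.
apply: (@le_trans _ _ (energy m (v |: A))).
  apply: Kmin; first exact: finset.setUS.
  by rewrite finset.subUset finset.sub1set setU11.
rewrite energyU1// -addrA gerDl subr_le0; apply: (@le_trans _ _ 0) => //.
by rewrite lerz0.
Qed.

End Leaf.

(** If m v > 0, the value at I is computed without the leaf and the value at
    v |: I with weight m - 1_u, up to the constant m v, whose alternating sum
    over the subsets of the nonempty set U vanishes. If m v <= 0, the values at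
    I and at v |: I cancel. *)
Lemma alt_min_energy_leaf m u v U : u \in U -> v \notin U ->
    (forall w, w \in U -> e v w = (w == u)) ->
  alt_min_energy m (v |: U) =
    if 0 < m v then alt_min_energy m U - alt_min_energy (lower_at u m) U else 0.
Proof.
move=> uU vU vE; rewrite /alt_min_energy alt_sumU1//; case: ltP => mv.
  pose cst (I : {set T}) : rat := (m v)%:~R.
  have cst0 : \sum_(I : {set T} | I \subset U) (-1) ^+ #|I|.+1 * cst I = 0.
    exact: (alt_sum_eq0 uU).
  rewrite -[RHS]subr0 -[X in _ - X]cst0 -!sumrN -!big_split.
  apply: eq_bigr => I IU /=; rewrite (min_energy_leaf_pos uU vU vE)//.
  by rewrite (min_energy_leafU1 _ uU vU vE)// /cst; ring.
by rewrite big1// => I IU; rewrite min_energy_leaf_neg// subrr mulr0.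
Qed.

Lemma alt_min_energy1 m v : alt_min_energy m [set v] = (Num.max (m v) 0)%:~R.
Proof.
rewrite /alt_min_energy -(finset.setU0 [set v]) alt_sumU1 ?inE//.
rewrite (eq_bigl (pred1 finset.set0)) => [|I]; last first.
  by rewrite /= finset.subset0.
rewrite big_pred1_eq cards0 expr1 mulN1r opprB finset.setU0.
rewrite (@min_energy_eq _ _ [set v] [set v])//; last first.
  by move=> A vA Av; have /eqP -> : A == [set v] by rewrite finset.eqEsubset Av.
rewrite energy1; case: (leP (m v) 0) => mv.
  rewrite (@min_energy_eq _ _ _ [set v]) ?finset.sub0set ?energy1 ?subrr//.
  move=> A _; rewrite subset1 => /orP[|] /eqP ->; rewrite ?energy0 ?energy1//.
  by rewrite lerz0.
rewrite (@min_energy_eq _ _ _ finset.set0) ?finset.sub0set ?energy0 ?subr0//.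
move=> A _; rewrite subset1 => /orP[|] /eqP ->; rewrite ?energy0 ?energy1//.
by rewrite ler0z ltW.
Qed.

(** Attaching the leaf v raises the degree of u by one and adds a factor
    trunc_diff 1 (m v), the indicator of m v > 0; the backward difference in m u
    that defines trunc_diff in degree d.+1 is the recursion of
    [alt_min_energy_leaf]. *)
Lemma alt_min_energy_tree U m : grown_tree U ->
  alt_min_energy m U = (\prod_(j in U) trunc_diff (degree_in U j) (m j))%:~R.
Proof.
move=> Ut; elim: Ut m => {U} [v|u v U _ IH uU vU vE] m.
  by rewrite alt_min_energy1 big_set1 degree_in1 e_irr.
rewrite (alt_min_energy_leaf m uU vU vE) big_setU1//=.
have degU1 j : degree_in (v |: U) j = (e j v + degree_in U j)%N.
  by rewrite /degree_in big_setU1.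
have -> : degree_in (v |: U) v = 1%N.
  by rewrite degU1 e_irr (degree_in_leaf uU vE)// uU.
rewrite trunc_diff1; case: ltP => _; last by rewrite mul0r.
rewrite mul1r !IH -rmorphB; congr (_%:~R).
rewrite !(bigD1 u uU)/= degU1 e_sym vE// eqxx add1n /= mulrBl.
congr (_ * _ - _ * _).
- apply: eq_bigr => j /andP[jU /negPf ju].
  by rewrite degU1 e_sym vE// ju.
- by rewrite /lower_at eqxx.
apply: eq_bigr => j /andP[jU /negPf ju].
by rewrite degU1 e_sym vE// ju /lower_at ju subr0.
Qed.

Lemma grown_tree_connected U x y : grown_tree U -> x \in U -> y \in U ->
  connect (fun a b => e a b && (b \in U)) x y.
Proof.
move=> Ut xU yU.
have [z zU zc] : exists2 z, z \in U & forall x, x \in U ->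
    connect (fun a b => e a b && (b \in U)) x z /\
    connect (fun a b => e a b && (b \in U)) z x.
  elim: Ut {x y xU yU} => {U} [v|u v U _ [z zU zc] uU vU vE].
    by exists v; rewrite ?inE// => x; rewrite inE => /eqP ->; rewrite !connect0.
  have sub a b : connect (fun a b => e a b && (b \in U)) a b ->
      connect (fun a b => e a b && (b \in v |: U)) a b.
    apply: connect_sub => {}a {}b /andP[ab bU]; apply: connect1.
    by rewrite ab in_setU1 bU orbT.
  exists z => [|x]; first by rewrite in_setU1 zU orbT.
  rewrite in_setU1 => /orP[/eqP -> {x}|xU]; last first.
    by case: (zc _ xU) => *; split; exact: sub.
  have [uz zu] := zc _ uU; split.
    apply: connect_trans (sub _ _ uz); apply: connect1.
    by rewrite vE// eqxx in_setU1 uU orbT.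
  apply: connect_trans (sub _ _ zu) _; apply: connect1.
  by rewrite e_sym vE// eqxx setU11.
by apply: connect_trans (zc _ xU).1 (zc _ yU).2.
Qed.

(** A subtree with the largest number of vertices is the whole graph: by
    connectedness some vertex v outside it would be adjacent to it, and by
    acyclicity to a single vertex of it, so that v could be attached. *)
Lemma grown_treeT (x0 : T) : (forall x y, connect e x y) ->
    (forall c : seq T, ucycle e c -> (size c <= 2)%N) ->
  grown_tree [set: T].
Proof.
move=> conn acyc.
pose P (n : nat) := `[< exists2 U, grown_tree U & #|U| = n >].
have exP : exists n, P n.
  by exists 1; apply/asboolP; exists [set x0]; rewrite ?cards1//; exact: Grown1.
have leP n : P n -> (n <= #|T|)%N by move=> /asboolP[U _ <-]; exact: max_card.
case: (ex_maxnP exP leP) => n /asboolP[U Ut Un] nmax.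
suff /eqP <- : U == [set: T] by [].
rewrite finset.eqEsubset finset.subsetT/=.
apply/negPn/negP => /subsetPn[y _ yU].
have [x xU] : exists x, x \in U.
  by case: Ut => [v|u v W _ _ _ _]; exists v; rewrite !inE eqxx.
have [u uU [v vU uv]] : exists2 u, u \in U & exists2 v, v \notin U & e u v.
  have /connectP[p] := conn x y; elim: p x xU => [|a p IH] x xU /=.
    by move=> _ yx; rewrite yx xU in yU.
  move=> /andP[xa pa] ylast; have [aU|aU] := boolP (a \in U).
    exact: IH aU pa ylast.
  by exists x => //; exists a.
suff vE w : w \in U -> e v w = (w == u).
  have /nmax : P #|v |: U|.
    by apply/asboolP; exists (v |: U) => //; exact: GrownU1 vE.
  by rewrite cardsU1 vU Un add1n ltnn.
move=> wU; case: eqVneq => [->|wu]; first by rewrite e_sym.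
(* A second neighbour w of v in U closes a path of U from u to w to a cycle. *)
apply/negP => vw; have := grown_tree_connected Ut uU wU.
case/connectP => p0 p0e wlast; move: wU wu vw; rewrite {w}wlast.
case/shortenP: p0e => p up pU _ wU wu vw.
have pUe : path e u p by apply: sub_path up => a b /andP[].
have pinU : all (mem U) p.
  elim: p u up {pU pUe uU uv wu vw wU} => //= a p IH u.
  by move=> /andP[/andP[_ ->]] /IH ->.
have : ucycle e (v :: u :: p).
  rewrite /ucycle /= e_sym uv rcons_path pUe/= e_sym vw/=.
  move: pU => /= ->; rewrite andbT in_cons negb_or.
  rewrite (contraNneq _ vU) => [/=|-> //]; apply: contra vU; exact: (allP pinU).
move/acyc => /=; rewrite !ltnS leqn0 size_eq0 => /eqP p0E.
by rewrite p0E eqxx in wu.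
Qed.

End GraphEnergy.

(** * Taylor coefficients *)

Section TaylorCoefficients.
Variable R : realType.

Lemma is_derive_one_sub_exprz (z : int) (x : R) : x < 1 ->
  is_derive x 1 (fun y : R => (1 - y) ^ z) (- z%:~R * (1 - x) ^ (z - 1)).
Proof.
move=> x1; have x0 : 1 - x != 0 by rewrite subr_eq0 gt_eqF.
have D : is_derive x 1 (fun y : R => 1 - y) (- 1).
  by rewrite -[X in is_derive _ _ _ X]add0r; apply: is_deriveB.
have DX n : is_derive x 1 (fun y : R => (1 - y) ^+ n)
    (- n%:R * (1 - x) ^+ n.-1).
  have := is_deriveX n D; rewrite exprfctE => DX; apply: (is_derive_eq DX).
  by rewrite -[LHS]/(_ * _); ring.
case: z => n.
  apply: (is_derive_eq (DX n)); case: n => [|n]; first by rewrite !oppr0 !mul0r.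
  by rewrite (_ : Posz n.+1 - 1 = n)//; lia.
have xn0 : (1 - x) ^+ n.+1 != 0 by rewrite expf_neq0.
have DV : is_derive x 1 (fun y : R => (1 - y) ^ Negz n) _ :=
  @is_deriveV R (fun y : R => (1 - y) ^+ n.+1) x _ 1 xn0 (DX n.+1).
apply: (is_derive_eq DV).
rewrite (_ : Negz n - 1 = Negz n.+1); last by lia.
rewrite -[LHS]/(_ * _) NegzE mulrNz opprK.
rewrite -[(1 - x) ^ Negz n.+1]/((1 - x) ^- n.+2) /=.
rewrite -[n.+1%:~R]/(n.+1%:R) !exprS; field.
by rewrite expf_neq0//= x0.
Qed.

Lemma derive1n_one_sub_exprz (z : int) n (x : R) : x < 1 ->
  derive1n n (fun y : R => (1 - y) ^ z) x =
    (\prod_(i < n) (i%:Z - z))%:~R * (1 - x) ^ (z - n%:Z).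
Proof.
elim: n x => [|n IH] x x1; first by rewrite derive1n0 big_ord0 mul1r subr0.
set c : R := (\prod_(i < n) (i%:Z - z))%:~R in IH.
rewrite derive1nS derive1E.
(* The induction hypothesis holds for y < 1, hence on a neighbourhood of x. *)
rewrite (near_eq_derive (g := fun y : R => c * (1 - y) ^ (z - n%:Z))).
  have := is_deriveZ c (is_derive_one_sub_exprz (z - n%:Z) x1).
  move/(@derive_val _ _ _ _ _ _ _) => ->.
  rewrite big_ord_recr/= -[LHS]/(_ * _) intrM mulrA; congr (_ * _).
    by rewrite -mulrNz opprB.
  by congr (_ ^ _); lia.
by near=> y; apply: IH; near: y; exact: lt_nbhsl.
Unshelve. all: by end_near. Qed.

Lemma chi_coefE (d n : nat) :
  chi_coef R d n = (\prod_(i < n) (i%:Z - (d%:Z - 2)))%:~R / n`!%:R.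
Proof. by rewrite /chi_coef derive1n_one_sub_exprz// subr0 exp1rz mulr1. Qed.

Lemma chi_coef0n n : chi_coef R 0 n = n.+1%:R.
Proof.
rewrite chi_coefE (_ : \prod_(i < n) _ = (n.+1)`!%:Z).
  rewrite factS -[_%:~R]/(_%:R) natrM mulfK// pnatr_eq0 -lt0n fact_gt0//.
elim: n => [|n IH]; first by rewrite big_ord0.
by rewrite big_ord_recr/= IH [n.+2`!]factS PoszM mulrC; congr (_ * _); lia.
Qed.

Lemma chi_coefn0 d : chi_coef R d 0 = 1.
Proof. by rewrite chi_coefE big_ord0 divr1. Qed.

(** Multiplying (1 - x)^(d - 2) by 1 - x. *)
Lemma chi_coefSS d n :
  chi_coef R d.+1 n.+1 = chi_coef R d n.+1 - chi_coef R d n.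
Proof.
rewrite !chi_coefE.
have n0 : (n`!%:R : R) != 0 by rewrite pnatr_eq0 -lt0n fact_gt0.
have n1 : (n.+1%:R : R) != 0 by rewrite pnatr_eq0.
rewrite factS natrM big_ord_recl/= big_ord_recr/=.
rewrite (eq_bigr (fun i : 'I_n => (i%:Z - (d%:Z - 2)))); last first.
  by move=> i _; rewrite /bump /=; lia.
set p := \prod_(i < n) _; rewrite !intrM !intrB.
rewrite -natr1 in n1 *.
field.
by rewrite n0 n1.
Qed.

Lemma chi_coef_trunc_diff d n : chi_coef R d n = (trunc_diff d n.+1)%:~R.
Proof.
elim: d n => [|d IH] n; first by rewrite chi_coef0n/= max_l.
case: n => [|n].
  rewrite chi_coefn0.
  by rewrite /= (@trunc_diff_le0 d (1 - 1))// subr0 -IH chi_coefn0.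
rewrite chi_coefSS !IH /= (_ : Posz n.+2 - 1 = n.+1) ?intrB//; lia.
Qed.

End TaylorCoefficients.

(** * Resolution graphs *)

Section ResolutionGraph.
Variable G : resolution_graph.
Local Notation V := 'I_(nvert G).
Local Notation e := (@adj G).
Implicit Types (u v w l : LQ G) (i j : V) (A B I : {set V}).
Implicit Types (n : expo (nvert G)).

Lemma formC u v : form u v = form v u.
Proof.
have imatT : (imat G)^T = imat G.
  by apply/matrixP => i j; rewrite !mxE eq_sym adj_sym; case: eqP => [->|].
rewrite /form /bilinear_form; transitivity ((u *m imat G *m v^T)^T 0 0).
  by rewrite [RHS]mxE.
by rewrite !trmx_mul trmxK imatT mulmxA.
Qed.

Lemma form0l u : form 0 u = 0.
Proof. by rewrite formC form0r. Qed.

Lemma form_suml (I : finType) (P : pred I) (F : I -> LQ G) u :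
  form (\sum_(i | P i) F i) u = \sum_(i | P i) form (F i) u.
Proof.
by apply: (big_morph (fun v => form v u)) => [v w|]; rewrite ?form0l ?formDl.
Qed.

Lemma form_dual_comb n j : form (dual_comb n) (E j) = - (n j)%:R.
Proof.
rewrite form_suml (bigD1 j)//= big1 ?addr0 => [|i /negPf ij].
  elim: (n j) => [|k IH]; first by rewrite mulr0n form0l oppr0.
  by rewrite mulrSr formDl IH form_Estar eqxx -opprD natr1.
elim: (n i) => [|k IH]; first by rewrite mulr0n form0l.
by rewrite mulrSr formDl IH form_Estar ij oppr0 addr0.
Qed.

Lemma form_E_Esum i A :
  form (E i) (Esum A) = (selfint i)%:~R *+ (i \in A) + (degree_in e A i)%:R.
Proof.
rewrite formC form_suml /degree_in natr_sum.
rewrite (eq_bigr _ (fun k _ => form_EE k i)).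
rewrite [X in _ = X + _](_ : _ = \sum_(k in A) (selfint i)%:~R *+ (k == i)).
  rewrite -big_split/=; apply: eq_bigr => k _; case: eqP => [->|_].
    by rewrite adj_irr mulr1n addr0.
  by rewrite mulr0n add0r adj_sym.
case: (boolP (i \in A)) => iA.
  by rewrite (bigD1 i)//= eqxx big1 ?addr0// => k /andP[_ /negPf ->].
by rewrite big1// => k kA; case: eqP => // ki; rewrite -ki kA in iA.
Qed.

Definition dual_weight n : V -> int := fun j => (n j).+1.

(** Adjunction gives chi(E_j) = 1, so chi(E_A) is the number of vertices minus
    the number of edges of A, and each j in A contributes -(l', E_j) = n_j. *)
Lemma chi_add_Esum n A : chi (dual_comb n + Esum A) =
  chi (dual_comb n) + energy e (dual_weight n) A.
Proof.
have canE j : form (E j) (canonical G) = - 2 - (selfint j)%:~R.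
  have := canonicalP j; rewrite formDl formC form_EE eqxx => <-.
  by rewrite addrK.
set l := dual_comb n; set x := Esum A.
have lx : form l x = - \sum_(j in A) (n j)%:R.
  rewrite formC form_suml -sumrN; apply: eq_bigr => j _.
  by rewrite formC form_dual_comb.
have xx : form x (x + canonical G) =
    (\sum_(j in A) degree_in e A j)%:R - \sum_(j in A) 2.
  rewrite form_suml natr_sum -sumrB; apply: eq_bigr => j jA.
  by rewrite formDr canE form_E_Esum jA mulr1n; ring.
have -> : energy e (dual_weight n) A =
    \sum_(j in A) (n j)%:R + (\sum_(j in A) 2) / 2
    - (\sum_(j in A) degree_in e A j)%:R / 2.
  rewrite /energy mulr_suml -big_split/=; congr (_ - _); apply: eq_bigr => j _.
  by rewrite /dual_weight -[_%:~R]/(_%:R) -natr1 divff.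
rewrite /chi -addrA (formDl l x) !(formDr _ _ l) (formDr l _ x) xx.
rewrite (formC x l) lx.
by field.
Qed.

Lemma J_admissibleE n I A : J_admissible (dual_comb n) I A =
  (I \subset A) && [forall j, (j \notin A) ==> (degree_in e A j <= n j)%N].
Proof.
rewrite /J_admissible negb_exists; congr (_ && _); apply: eq_forallb => j.
rewrite negb_and -implybE; case: (boolP (j \in A)) => //= jA.
rewrite formDr formC form_dual_comb form_E_Esum (negPf jA) mulr0n add0r.
by rewrite addrC subr_gt0 ltr_nat -leqNgt.
Qed.

Lemma dual_graph_grown_tree : grown_tree e [set: V].
Proof.
apply: (@grown_treeT _ e (@adj_sym G) (Ordinal (nvert_gt0 G))).
  exact: adj_connected.
exact: adj_acyclic.
Qed.

(** A largest minimizer B is admissible, hence contains J; and passing from J to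
    B does not lower the energy: each vertex of B outside J has at most n_j
    neighbours in J, and these vertices span a forest. *)
Lemma min_energy_J n I :
  min_energy e (dual_weight n) [set: V] I =
    energy e (dual_weight n) (J (dual_comb n) I).
Proof.
set m := dual_weight n; set l := dual_comb n.
pose mini B := (I \subset B) && (energy e m B == min_energy e m [set: V] I).
have [|B Bmax] := @ex_maxset _ mini.
  rewrite /mini.
  case: (@min_energyP _ e m [set: V] I (finset.subsetT _)) => K IK _ _.
  by exists K; rewrite IK eqxx.
have /andP[IB /eqP Bmin] := maxsetp Bmax.
have Badm : J_admissible l I B.
  rewrite J_admissibleE IB/=; apply/forallP => j; apply/implyP => jB.
  rewrite leqNgt; apply/negP => nj.
  have : mini (j |: B).
    have IjB : I \subset j |: B.
      exact: fintype.subset_trans IB (finset.subsetUr _ _).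
    rewrite /mini IjB/= eq_le min_energy_le ?finset.subsetT// andbT -Bmin.
    rewrite (energyU1 (@adj_sym G) (@adj_irr G))// -addrA gerDl subr_le0.
    by rewrite /m /dual_weight -[_%:~R]/(_%:R) ler_nat.
  move=> /(maxsetsup Bmax)/(_ (finset.subsetUr _ _)) BE.
  by rewrite -BE setU11 in jB.
have JB : J l I \subset B.
  have := J_admissibleI (minsetp (J_minset l I)) Badm.
  move/(minsetinf (J_minset l I))/(_ (finset.subsetIl _ _)) <-.
  exact: finset.subsetIr.
have := minsetp (J_minset l I).
rewrite J_admissibleE => /andP[IJ /forallP Jsat].
apply/le_anti; rewrite min_energy_le ?finset.subsetT//= -Bmin.
set W := B :\: J l I.
have -> : B = J l I :|: W.
  by rewrite -(finset.setID B (J l I)) (finset.setIidPr JB).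
rewrite (energyU (@adj_sym G)); last first.
  rewrite finset.disjoints_subset /W finset.setDE finset.setCI finset.setCK.
  exact: finset.subsetUr.
rewrite -addrA lerDl.
have -> : energy e m W = energy e (fun=> 1) W + \sum_(j in W) (n j)%:R.
  rewrite /energy addrAC -big_split/=; congr (_ - _); apply: eq_bigr => j _.
  by rewrite /m /dual_weight -[_.+1%:~R]/(_%:R) -nat1r.
rewrite -addrA addr_ge0//.
  apply: (grown_tree_energy1 (@adj_sym G) (@adj_irr G) dual_graph_grown_tree).
  exact: finset.subsetT.
rewrite natr_sum -sumrB sumr_ge0// => j; rewrite inE => /andP[jJ _].
by rewrite subr_ge0 ler_nat; have := Jsat j; rewrite jJ.
Qed.

Lemma degree_inT j : degree_in e [set: V] j = valency j.
Proof.
rewrite /degree_in /valency -sum1_card big_mkcond/= [RHS]big_mkcond/=.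
by apply: eq_bigr => i _; rewrite !inE; case: (e j i).
Qed.

Lemma chi_alt_sum_dual n : chi_alt_sum (dual_comb n) =
  (\prod_j trunc_diff (valency j) (n j).+1)%:~R.
Proof.
have -> : \prod_j trunc_diff (valency j) (n j).+1 =
    \prod_(j in [set: V]) trunc_diff (degree_in e [set: V] j) (dual_weight n j).
  by apply: eq_big => [j|j _]; rewrite ?inE ?degree_inT.
have treeT := dual_graph_grown_tree.
rewrite -(alt_min_energy_tree (@adj_sym G) (@adj_irr G) _ treeT).
have c0 : \sum_(I : {set V} | I \subset [set: V])
    (-1) ^+ #|I|.+1 * chi (dual_comb n) = 0.
  have vT : Ordinal (nvert_gt0 G) \in [set: V] by rewrite inE.
  by apply: (alt_sum_eq0 (F := fun=> _) vT).
rewrite /alt_min_energy -[RHS]add0r -[X in X + _]c0 -big_split/=.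
rewrite /chi_alt_sum; apply: eq_big => [I|I _]; first by rewrite finset.subsetT.
by rewrite min_energy_J chi_add_Esum mulrDr.
Qed.

Lemma dual_comb_Sprime n : Sprime G (dual_comb n).
Proof.
split=> j; rewrite form_dual_comb; last by rewrite oppr_le0 ler0n.
by rewrite rpredN natr_int.
Qed.

Lemma Sprime_dual_comb l : Sprime G l -> exists n, l = dual_comb n.
Proof.
move=> [lint lneg]; exists [ffun j => `|Num.floor (form l (E j))|%N].
apply: form_E_inj => j; rewrite form_dual_comb ffunE.
have /intrP[k kE] := lint j; have := lneg j; rewrite kE intrKfloor lerz0 => k0.
by rewrite pmulrn -mulrNz abszE ler0_norm// opprK.
Qed.

End ResolutionGraph.

(** * Formal series *)

Local Open Scope classical_set_scope.

Section FormalSeries.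
Variable R : realType.

Lemma formal_sum_notin (M I : choiceType) (D : set I) (a : I -> R)
    (f : I -> M) v :
  (forall i, D i -> f i <> v) -> formal_sum D a f v = 0.
Proof.
move=> Dv; rewrite /formal_sum (_ : _ `&` _ = set0) ?fsbig_set0//.
by apply/seteqP; split=> // i [/Dv].
Qed.

Variable s : nat.
Implicit Types (v : expo s) (j : 'I_s).

Lemma one_sub_var_powE j d v : one_sub_var_pow R j d v =
  if v == var_pow j (v j) then chi_coef R d (v j) else 0.
Proof.
rewrite /one_sub_var_pow; case: eqP => [vE|vE].
  rewrite {1}vE formal_sum_inj// => m n _ _ /ffunP/(_ j).
  by rewrite !ffunE eqxx.
apply: formal_sum_notin => n _ vn; apply: vE; rewrite -vn.
by rewrite {2}/var_pow ffunE eqxx.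
Qed.

(** The factors being series in distinct variables, only one way of distributing
    the exponents of a monomial among them contributes. *)
Lemma big_one_sub_var_powE (r : seq 'I_s) (d : 'I_s -> nat) v : uniq r ->
  (\big[fps_mul R s / fps_one R s]_(j <- r) one_sub_var_pow R j (d j)) v =
  if [forall j, (j \notin r) ==> (v j == 0%N)]
  then \prod_(j <- r) chi_coef R (d j) (v j) else 0.
Proof.
elim: r v => [|k r IH] v /=.
  move=> _; rewrite !big_nil /fps_one; case: ifPn => [/forallP v0|/forallPn[j]].
    have -> : v = [ffun=> 0%N] by apply/ffunP => j; rewrite ffunE; apply/eqP/v0.
    by rewrite eqxx.
  rewrite /= => vj; case: eqP => // v0; move: vj.
  by rewrite v0 ffunE eqxx.
move=> /andP[kr ur]; rewrite !big_cons /fps_mul.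
(* v splits as its k-th component and w, its part in the other variables. *)
pose w : expo s := [ffun j => if j == k then 0%N else v j].
have addE : expo_add (var_pow k (v k)) w = v.
  apply/ffunP => j; rewrite !ffunE.
  by case: eqP => [->|_]; rewrite ?addn0 ?add0n.
rewrite -(@fsbig_widen _ _ _ _ [set (var_pow k (v k), w)]); first last.
- move=> [a b] [/= abv abn].
  rewrite one_sub_var_powE IH//; case: eqP => [aE|_]; last by rewrite mul0r.
  case: ifPn => [/forallP bE|_]; last by rewrite mulr0.
  have bk : b k = 0%N by apply/eqP; have := bE k; rewrite kr.
  have ak : a k = v k by rewrite -abv ffunE bk addn0.
  exfalso; apply: abn; congr (_, _); first by rewrite aE ak.
  apply/ffunP => j; rewrite ffunE; case: eqP => [->//|/eqP/negPf jk].
  by rewrite -abv ffunE aE /var_pow ffunE jk.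
- by move=> _ -> /=.
rewrite fsbig_set1/= one_sub_var_powE {3}/var_pow ffunE eqxx IH//.
have -> : [forall j, (j \notin r) ==> (w j == 0%N)] =
          [forall j, (j \notin k :: r) ==> (v j == 0%N)].
  apply: eq_forallb => j; rewrite in_cons negb_or /w ffunE.
  by case: (eqVneq j k) => [->|_]; rewrite ?eqxx ?implybT.
rewrite {1}/var_pow eqxx; case: ifP => _; last by rewrite mulr0.
congr (_ * _); rewrite !big_seq; apply: eq_bigr => j jr.
by rewrite /w ffunE; case: eqP => // jk; rewrite -jk jr in kr.
Qed.

End FormalSeries.

Lemma chi_alt_sum_prod (R : realType) (G : resolution_graph)
    (n : expo (nvert G)) :
  ratr (chi_alt_sum (dual_comb n)) = \prod_j chi_coef R (valency j) (n j).
Proof.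
rewrite chi_alt_sum_dual ratr_int rmorph_prod/=.
by apply: eq_bigr => j _; rewrite chi_coef_trunc_diff.
Qed.

Theorem theorem3p3p4 (R : realType) (G : resolution_graph) :
  [/\ formal_sum (Sprime G) (fun l : LQ G => ratr (chi_alt_sum l) : R)
        (fun l : LQ G => l)
      = Zseries R G,
      formal_sum [set: expo (nvert G)]
        (fun n : expo (nvert G) => ratr (chi_alt_sum (dual_comb n)) : R)
        (fun n : expo (nvert G) => n)
      = \big[fps_mul R (nvert G) / fps_one R (nvert G)]_(j < nvert G)
          one_sub_var_pow R j (valency j)
    & forall n : expo (nvert G),
        ratr (chi_alt_sum (dual_comb n)) =
        \prod_(j < nvert G) chi_coef R (valency j) (n j)].
Proof.
split; last exact: chi_alt_sum_prod.
- apply: funext => l; rewrite /Zseries.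
  have [[n lE]|ldual] := pselect (exists n, l = dual_comb n).
    have lS := dual_comb_Sprime n.
    rewrite lE formal_sum_inj//; last by move=> m k _ _; exact: dual_comb_inj.
    rewrite (@formal_sum_inj _ _ _ _ _ (fun l => l) (dual_comb n))//.
    exact: chi_alt_sum_prod.
  rewrite !formal_sum_notin// => [n _ nl|k kS kl]; apply: ldual.
    by exists n.
  by rewrite -kl; exact: Sprime_dual_comb.
- apply: funext => n.
  rewrite (@formal_sum_inj _ _ _ _ _ (fun n => n) n)// chi_alt_sum_prod.
  rewrite big_one_sub_var_powE ?index_enum_uniq//.
  by rewrite (introT forallP) // => j; rewrite mem_index_enum.
Qed.
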